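(* For $n\ge 3$, $$\frac{4}{9}\binom{n}{2}-O(n)\;\le\;\mathrm{ex}_\circlearrowright(n,D_2)\;\le\;\frac{2n^2-3n}{9}.$$
   Context: $\Omega_n=\{v_0,\dots,v_{n-1}\}$ is the vertex set of a regular $n$-gon with the clockwise cyclic ordering. We write $x_1<x_2<\dots<x_k<x_1$ to mean that $x_1,\dots,x_k$ are distinct and occur in this clockwise cyclic order. A convex geometric hypergraph (cgh) on $\Omega_n$ is a set $H$ of $3$-element subsets (edges) of $\Omega_n$. A cgh $H$ contains a cgh $F$ if there is an injection from the vertex set of $F$ to the vertex set of $H$ preserving the cyclic ordering and mapping edges to edges; otherwise $H$ is $F$-free. $\mathrm{ex}_\circlearrowright(n,F)$ is the maximum number of edges in an $F$-free cgh on $\Omega_n$. $D_2$ is the cgh with two edges $\{x_1,x_2,x_3\},\{x_1,x_2,x_4\}$, where $x_1<x_2<x_3<x_4<x_1$ (two distinct triangles sharing a side and lying on the same side of it). Here $O(n)$ denotes a quantity bounded by $cn$ for some absolute constant $c>0$ and all $n$. The lower bound is due to Damásdi and N. Frankl. *)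

(* Defs.v *)
From mathcomp Require Import all_boot.
Set Implicit Arguments.
Unset Strict Implicit.
Unset Printing Implicit Defensive.

(* The vertex v_i of the regular n-gon is i : 'I_n, indexed clockwise.
   [clockwise [:: x_1; ...; x_k]] is x_1 < ... < x_k < x_1: read from a suitable
   starting point, the indices strictly increase (so the x_i are distinct). *)
Definition clockwise (n : nat) (s : seq 'I_n) : bool :=
  [exists r : 'I_(size s).+1, sorted ltn (rot r [seq val x | x <- s])].

Definition is_cgh (n : nat) (H : {set {set 'I_n}}) : bool :=
  [forall e in H, #|e| == 3].

(* A cyclic ordering is a ternary relation, so preserving it is a condition on
   triples. *)
Definition preserves_cyclic_order (m n : nat) (f : {ffun 'I_m -> 'I_n}) : bool :=
  [forall x, forall y, forall z,
     clockwise [:: x; y; z] ==> clockwise [:: f x; f y; f z]].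

Definition cgh_contains (m n : nat)
    (F : {set {set 'I_m}}) (H : {set {set 'I_n}}) : bool :=
  [exists f : {ffun 'I_m -> 'I_n},
     [&& injectiveb f, preserves_cyclic_order f & [forall e in F, f @: e \in H]]].

Definition cgh_free (m n : nat)
    (F : {set {set 'I_m}}) (H : {set {set 'I_n}}) : bool :=
  ~~ cgh_contains F H.

Definition ex_cyc (n m : nat) (F : {set {set 'I_m}}) : nat :=
  \max_(H : {set {set 'I_n}} | is_cgh H && cgh_free F H) #|H|.

Definition D2 : {set {set 'I_4}} :=
  let x1 : 'I_4 := inord 0 in let x2 : 'I_4 := inord 1 in
  let x3 : 'I_4 := inord 2 in let x4 : 'I_4 := inord 3 in
  [set [set x1; x2; x3]; [set x1; x2; x4]].

(* Main.v *)
(** In a clockwise triple (x, y, z) the directed side (x, y) has the third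
    vertex on a prescribed side, so [H] is [D2]-free iff every ordered pair
    (x, y) lies in at most one clockwise triple spanning an edge of [H]. Let [P]
    be the set of these triples, so that #|P| = 3 #|H|.

    Upper bound: the clockwise gaps of a triangle sum to n, so the gaps of the
    #|P| directed sides sum to n #|P| / 3. On the other hand each gap occurs at
    most n times, so this sum is at least that of a set using up the smallest
    gaps, which is at least #|P| (#|P| + n) / (2n).

    Lower bound: for m = 2j + 1 with 9j + 6 <= n < 9j + 15 there are m triples of
    gaps with sum n whose 3m entries are all distinct. The rotations of the
    corresponding triangles form a [D2]-free family of n m edges. *)
Require Import Defs.
From HB Require Import structures.
From mathcomp Require Import all_boot all_order all_algebra.
From mathcomp Require Import zify lra.
Set Implicit Arguments.
Unset Strict Implicit.
Unset Printing Implicit Defensive.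
Import Order.TTheory GRing.Theory Num.Theory.

(** * Clockwise triples, gaps, and triangles as clockwise triples up to rotation *)

Definition cw (x y z : nat) : bool :=
  [|| (x < y < z)%N, (y < z < x)%N | (z < x < y)%N].

Lemma clockwise3 n (x y z : 'I_n) : clockwise [:: x; y; z] = cw x y z.
Proof.
rewrite /clockwise /cw /=; apply/existsP/idP => [[[r /= lr]]|].
  by case: r lr => [|[|[|[|r]]]] //= _; rewrite /rot /=; lia.
case/or3P => h.
- by exists (@Ordinal 4 0 isT); rewrite /rot /=; lia.
- by exists (@Ordinal 4 1 isT); rewrite /rot /=; lia.
- by exists (@Ordinal 4 2 isT); rewrite /rot /=; lia.
Qed.

(** Clockwise distance from [x] to [y], with value [n] rather than 0 when [x = y]. *)
Definition gap (n x y : nat) : nat := if x < y then y - x else y + n - x.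

Lemma gap_sum n (x y z : 'I_n) :
  cw x y z -> gap n x y + gap n y z + gap n z x = n.
Proof.
move: (ltn_ord x) (ltn_ord y) (ltn_ord z); rewrite /cw /gap.
by case: (ltnP x y); case: (ltnP y z); case: (ltnP z x); lia.
Qed.

Lemma gap_inj n (x y z : 'I_n) : gap n x y = gap n x z -> y = z.
Proof.
move: (ltn_ord x) (ltn_ord y) (ltn_ord z); rewrite /gap => ? ? ? h.
by apply: val_inj => /=; move: h; case: (ltnP x y); case: (ltnP x z); lia.
Qed.

Definition edge n (t : 'I_n * 'I_n * 'I_n) : {set 'I_n} :=
  [set t.1.1; t.1.2; t.2].

Lemma cw_edge_eq n (x y z x' y' z' : 'I_n) :
  cw x y z -> cw x' y' z' -> edge (x, y, z) = edge (x', y', z') ->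
  [\/ (x, y, z) = (x', y', z'), (x, y, z) = (y', z', x')
    | (x, y, z) = (z', x', y')].
Proof.
rewrite /edge /= => h h' /setP E.
move: (E x) (E y) (E z); rewrite !inE !eqxx ?orbT /=.
move=> /esym/orP[/orP[]|]/eqP ex /esym/orP[/orP[]|]/eqP ey /esym/orP[/orP[]|]/eqP ez;
  subst; try by constructor.
(* The remaining matchings repeat a vertex or reverse the orientation. *)
all: by exfalso; move: h h'; rewrite /cw; lia.
Qed.

Lemma card_edge n (x y z : 'I_n) : cw x y z -> #|edge (x, y, z)| = 3.
Proof.
move=> h; rewrite /edge /= setUC cardsU1 cards2 !inE.
by move: h; rewrite -!val_eqE /cw /=; lia.
Qed.

Lemma card3_edge n (e : {set 'I_n}) :
  #|e| = 3 -> exists x y z : 'I_n, cw x y z /\ e = edge (x, y, z).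
Proof.
have [[|x [|y [|z [|? ?]]]] //= + _] := cards_eqP e.
rewrite !inE !andbT negb_or => /andP[/andP[nxy nxz] nyz].
have [h|h] := boolP (cw x y z).
  by exists x, y, z; split=> //; apply/setP => v; rewrite !inE orbA.
exists x, z, y; split; last by apply/setP => v; rewrite !inE -!orbA (orbC (v == y)).
by move: nxy nxz nyz h; rewrite -!val_eqE /cw /=; lia.
Qed.

(** * Containment of [D2] in terms of clockwise triples *)

Lemma D2_containedP n (H : {set {set 'I_n}}) :
  reflect (exists x y z w : 'I_n,
      [/\ cw x y z, cw x y w, z != w, edge (x, y, z) \in H & edge (x, y, w) \in H])
    (cgh_contains D2 H).
Proof.
apply: (iffP idP).
  case/existsP => f /and3P[/injectiveP fi /forallP fo /forallP fH].
  exists (f (inord 0)), (f (inord 1)), (f (inord 2)), (f (inord 3)).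
  have O (x y z : 'I_4) : cw x y z -> cw (f x) (f y) (f z).
    move: (fo x) => /forallP/(_ y)/forallP/(_ z)/implyP; rewrite !clockwise3.
    exact.
  split.
  - by apply: O; rewrite !inordK.
  - by apply: O; rewrite !inordK.
  - by rewrite (inj_eq fi) -val_eqE /= !inordK.
  - have := fH [set inord 0; inord 1; inord 2]; rewrite /D2 !inE eqxx /=.
    by rewrite !imsetU !imset_set1.
  - have := fH [set inord 0; inord 1; inord 3]; rewrite /D2 !inE eqxx orbT /=.
    by rewrite !imsetU !imset_set1.
case=> [x [y [z [w [h1 h2 nzw e1 e2]]]]].
(* The two third vertices play symmetric roles, so [z] may be taken to come before [w]. *)
wlog h3 : z w h1 h2 nzw e1 e2 / cw y z w.
  move=> W; have [|] := boolP (cw y z w); first exact: W e1 e2.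
  move=> h; apply: (W w z) => //; first by rewrite eq_sym.
  by move: h1 h2 h nzw; rewrite /cw -val_eqE /=; lia.
pose f := [ffun i : 'I_4 => nth x [:: x; y; z; w] i].
apply/existsP; exists f; apply/and3P; split.
- apply/injectiveP; case=> [[|[|[|[|i]]]] hi] //; case=> [[|[|[|[|k]]]] hk] //;
    rewrite !ffunE /= => E; apply: val_inj => //=;
    exfalso; subst; move: h1 h2 h3; rewrite /cw; lia.
- apply/forallP; case=> [[|[|[|[|i]]]] hi] //;
  apply/forallP; case=> [[|[|[|[|k]]]] hk] //;
  apply/forallP; case=> [[|[|[|[|l]]]] hl] //;
  rewrite !clockwise3 !ffunE /=; move: h1 h2 h3; rewrite /cw; lia.
apply/forallP => e; apply/implyP; rewrite /D2 !inE => /orP[]/eqP->.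
all: by rewrite !imsetU !imset_set1 !ffunE !inordK.
Qed.

(** * Upper bound: double counting of gaps *)

(** Induction on [k]: with [A <= n k] the sum so far and [u <= n] the new term, the left side grows
    by [2 A u + u^2 + n u <= 2 n (k + 1) u]. *)
Lemma weighted_sum_lower_bound (n : nat) (a : nat -> nat) (k : nat) :
  (forall g, a g <= n) ->
  (\sum_(1 <= g < k.+1) a g) ^ 2 + n * (\sum_(1 <= g < k.+1) a g)
    <= 2 * n * \sum_(1 <= g < k.+1) g * a g.
Proof.
move=> ha; elim: k => [|k IH]; first by rewrite !big_geq // !muln0.
have B : \sum_(1 <= g < k.+1) a g <= n * k.
  apply: leq_trans (_ : \sum_(1 <= g < k.+1) n <= _); first by apply: leq_sum => g _.
  by rewrite sum_nat_const_nat subn1 mulnC.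
rewrite !(big_nat_recr k.+1) //=.
move: (ha k.+1) B IH; move: (a k.+1) (\sum_(1 <= g < k.+1) a g) => u A.
move: (\sum_(1 <= g < k.+1) g * a g) => S ? ? ?; nia.
Qed.

Lemma gap_bounds n (x y : 'I_n) : 0 < gap n x y < n.+1.
Proof.
move: (ltn_ord x) (ltn_ord y); rewrite /gap; case: (ltnP x y); lia.
Qed.

Section UpperBound.
Variables (n : nat) (H : {set {set 'I_n}}).
Hypotheses (cghH : is_cgh H) (freeH : cgh_free D2 H).

Let P := [set t : 'I_n * 'I_n * 'I_n | cw t.1.1 t.1.2 t.2 && (edge t \in H)].

Lemma free_arc_inj (t u : 'I_n * 'I_n * 'I_n) :
  t \in P -> u \in P -> t.1 = u.1 -> t = u.
Proof.
case: t u => [[x y] z] [[x' y'] w]; rewrite !inE /=.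
move=> /andP[h1 e1] /andP[h2 e2] [? ?]; subst x' y'.
have [->//|nzw] := eqVneq z w.
by case/negP: freeH; apply/D2_containedP; exists x, y, z, w.
Qed.

Lemma edge_rot (x y z : 'I_n) : edge (y, z, x) = edge (x, y, z).
Proof. by apply/setP => v; rewrite !inE orbC orbA. Qed.

Lemma cw_rot (x y z : 'I_n) : cw y z x = cw x y z.
Proof. by rewrite /cw; lia. Qed.

(** The three rotations of a clockwise reading of an edge are distinct elements of [P]. *)
Lemma card_cw_triples : 3 * #|H| <= #|P|.
Proof.
rewrite -[#|P|]sum1_card (partition_big (@edge n) (mem H)) /=; last first.
  by move=> t; rewrite inE => /andP[].
rewrite mulnC -sum_nat_const; apply: leq_sum => e eH.
have /card3_edge [x [y [z [h E]]]] : #|e| = 3.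
  by have /forall_inP/(_ _ eH)/eqP := cghH.
have /card_uniqP D : uniq [:: (x, y, z); (y, z, x); (z, x, y)].
  rewrite /= !inE !xpair_eqE -!val_eqE /=.
  by move: h; rewrite /cw; lia.
rewrite sum1dep_card -[leqLHS]D; apply: subset_leq_card.
apply/subsetP => t; rewrite !inE => /or3P[]/eqP->.
- by rewrite /= E h -E eH eqxx.
- by rewrite /= edge_rot cw_rot h -E eH eqxx.
- by rewrite /= -edge_rot -cw_rot h -E eH eqxx.
Qed.

Let rot3 (t : 'I_n * 'I_n * 'I_n) := (t.1.2, t.2, t.1.1).

Lemma sum_rot3 (F : 'I_n * 'I_n * 'I_n -> nat) :
  \sum_(t in P) F t = \sum_(t in P) F (rot3 t).
Proof.
have rotK : cancel rot3 (fun t => (t.2, t.1.1, t.1.2)) by case=> [[]].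
rewrite (reindex_inj (can_inj rotK)); apply: eq_bigl => -[[x y] z].
by rewrite !inE -[rot3 _]/(y, z, x) /= cw_rot edge_rot.
Qed.

(** Rotation permutes [P], so first, second and third sides have equal gap sums, while the three
    gaps of each triple add up to [n]. *)
Lemma sum_gaps : 3 * \sum_(t in P) gap n t.1.1 t.1.2 = n * #|P|.
Proof.
pose F (t : 'I_n * 'I_n * 'I_n) := gap n t.1.1 t.1.2.
have E1 := sum_rot3 F; have E2 := sum_rot3 (F \o rot3).
have : \sum_(t in P) (F t + F (rot3 t) + F (rot3 (rot3 t))) = n * #|P|.
  rewrite mulnC -sum_nat_const; apply: eq_bigr => -[[x y] z].
  by rewrite inE /F /= => /andP[h _]; exact: gap_sum.
by rewrite !big_split; move: E1 E2; rewrite /F /=; lia.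
Qed.

Lemma sum_gaps_ge :
  #|P| ^ 2 + n * #|P| <= 2 * n * \sum_(t in P) gap n t.1.1 t.1.2.
Proof.
pose a g := \sum_(t in P | gap n t.1.1 t.1.2 == g) 1.
(* Regroup sums over [P] by gap; used with [w] the identity and [w] constantly 1. *)
have S (w : nat -> nat) :
    \sum_(t in P) w (gap n t.1.1 t.1.2) = \sum_(1 <= g < n.+1) w g * a g.
  under [RHS]eq_bigr => g _ do rewrite /a big_distrr /= big_mkcondr.
  rewrite exchange_big /=; apply: eq_bigr => -[[x y] z] _ /=.
  under eq_bigr => g _ do rewrite muln1 eq_sym.
  by rewrite -big_mkcond big_nat1_eq gap_bounds.
(* A start and a gap fix the directed side, hence by [D2]-freeness the triple. *)
have a_le g : a g <= n.
  rewrite /a sum1_card -[leqRHS]card_ord -(card_in_image (f := fun t => t.1.1)).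
    exact: max_card.
  move=> [[x y] z] [[x' y'] z']; rewrite !unfold_in /=.
  move=> /andP[tP /eqP gt] /andP[uP /eqP gu] E; subst x'.
  by apply: (free_arc_inj tP uP); rewrite /= (gap_inj (etrans gt (esym gu))).
have := weighted_sum_lower_bound n a_le.
rewrite -(S id) /=; have <- : #|P| = \sum_(1 <= g < n.+1) a g => //.
rewrite -sum1_card (S (fun=> 1)); apply: eq_bigr => g _; exact: mul1n.
Qed.

Lemma card_D2_free_le : 1 < n -> 9 * #|H| + 3 * n <= 2 * n ^ 2.
Proof.
move=> n1; move: card_cw_triples sum_gaps sum_gaps_ge.
move: #|H| #|P| (\sum_(t in P) _) => h p S ? ? ?.
(* For [p > 0], combining [3 S = n p] with [p^2 + n p <= 2 n S] and cancelling [p] gives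
   [3 p + 3 n <= 2 n^2]; then [3 h <= p]. For [p = 0] also [h = 0], and [n > 1] suffices. *)
by case: (posnP p) => ?; nia.
Qed.

End UpperBound.

(** * Lower bound: rotations of triangles with pairwise distinct gaps *)

Lemma sum_constant_triples n : 6 <= n ->
  exists m (a b c : nat -> nat), [/\ 2 * n <= 9 * m + 19,
    forall i, i < m -> [/\ a i + b i + c i = n, 0 < a i <= m,
                           m < b i <= 2 * m & 2 * m < c i],
    injective a,
    {in gtn m &, injective b} & {in gtn m &, injective c}].
Proof.
move=> n6; pose j := (n - 6) %/ 9.
have [jl ju] : 9 * j + 6 <= n /\ n < 9 * j + 15 by rewrite /j; lia.
(* [i |-> s i - i] permutes [0, 2j], and the [s i] are the integers in [j, 3j]. *)
pose s i := if odd i then 2 * j + 1 + i./2 else j + i./2.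
pose m := 2 * j + 1.
have s_inj i k : i < m -> k < m -> s i = s k -> i = k.
  by rewrite /s; case: ifP; case: ifP; lia.
have s_bounds i : i < m -> i <= s i /\ s i - i < m /\ s i <= 3 * j.
  by rewrite /s /m; case: ifP; lia.
(* The offsets put [a] in [1, m] and [b] in [m + 1, 2m]; [s i <= 3j] and [n >= 9j + 6] give
   [c i >= 4j + 3 = 2m + 1]. *)
exists m, succn, (fun i => m + 1 + (s i - i)), (fun i => n - m - 2 - s i).
split.
- by rewrite /m; lia.
- by move=> i im; have := s_bounds i im; rewrite /m in im *; split; lia.
- exact: succn_inj.
- move=> i k; rewrite !unfold_in /= => im km.
  rewrite /s /m in im km *; case: ifP; case: ifP; lia.
- move=> i k; rewrite !unfold_in /= => im km.
  have := s_bounds i im; have := s_bounds k km; move: (s_inj i k im km).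
  rewrite /m; lia.
Qed.

Section LowerBound.
Variables (n : nat) (n_gt0 : 0 < n).

Definition shift (x : 'I_n) (g : nat) : 'I_n := Ordinal (ltn_pmod (x + g) n_gt0).

Lemma val_shift x g : g < n ->
  shift x g = (if x + g < n then x + g else x + g - n) :> nat.
Proof.
move=> gn; rewrite /shift /=; case: ltnP => h; first by rewrite modn_small.
have -> : x + g = x + g - n + n by lia.
by rewrite modnDr modn_small ?addnK //; have := ltn_ord x; lia.
Qed.

Lemma shift_triangle (x : 'I_n) g h : 0 < g -> 0 < h -> g + h < n ->
  [/\ cw x (shift x g) (shift x (g + h)), gap n x (shift x g) = g,
      gap n (shift x g) (shift x (g + h)) = h
    & gap n (shift x (g + h)) x = n - (g + h)].
Proof.
move=> g0 h0 ghn; have xn := ltn_ord x.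
rewrite /cw /gap !val_shift //; last lia.
by case: (ltnP (x + g) n); case: (ltnP (x + (g + h)) n) => ? ?; split;
  try case: ifP; lia.
Qed.

Variables (m : nat) (a b c : nat -> nat).
Hypothesis abc : forall i, i < m ->
  [/\ a i + b i + c i = n, 0 < a i <= m, m < b i <= 2 * m & 2 * m < c i].
Hypotheses (a_inj : injective a) (b_inj : {in gtn m &, injective b})
  (c_inj : {in gtn m &, injective c}).

Let T (t : 'I_n * 'I_m) :=
  (t.1, shift t.1 (a t.2), shift t.1 (a t.2 + b t.2)).

Let H := [set edge (T t) | t : 'I_n * 'I_m].

Lemma T_triangle t (tr := T t) :
  [/\ cw tr.1.1 tr.1.2 tr.2, gap n tr.1.1 tr.1.2 = a t.2,
      gap n tr.1.2 tr.2 = b t.2 & gap n tr.2 tr.1.1 = c t.2].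
Proof.
have [abcn a_bd b_bd c_bd] := abc (ltn_ord t.2).
rewrite {}/tr /=; have [||| -> -> -> ->] := @shift_triangle t.1 (a t.2) (b t.2).
all: by [lia | split=> //; lia].
Qed.

Lemma T_gaps t (x y z : 'I_n) : cw x y z -> edge (x, y, z) = edge (T t) ->
  let i := t.2 in
  [\/ [/\ x = t.1, gap n x y = a i & gap n y z = b i],
      gap n x y = b i /\ gap n y z = c i
    | gap n x y = c i /\ gap n y z = a i].
Proof.
have [cwT ga gb gc] := T_triangle t => h /(cw_edge_eq h cwT)[][-> -> ->] /=.
- exact: Or31.
- exact: Or32.
- exact: Or33.
Qed.

Lemma T_family_free : cgh_free D2 H.
Proof.
apply/negP => /D2_containedP [x [y [z [w [h1 h2 /eqP nzw]]]]].
move=> /imsetP[[t i] _ e1] /imsetP[[u k] _ e2]; apply: nzw; apply: (@gap_inj _ y).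
have [? ? ? ?] := abc (ltn_ord i); have [? ? ? ?] := abc (ltn_ord k).
(* The common gap from [x] to [y] lies in only one of the three ranges, which excludes the mixed
   cases; injectivity then gives the same index, hence the same next gap. *)
case: (T_gaps h1 e1) => [[_]||] []; case: (T_gaps h2 e2) => [[_]||] [] /=;
  move=> -> -> E ->; try by exfalso; move: E; lia.
- by rewrite (a_inj E).
- by rewrite (b_inj _ _ E) // unfold_in /=.
- by rewrite (c_inj _ _ E) // unfold_in /=.
Qed.

Lemma T_family_cgh : is_cgh H.
Proof.
apply/forall_inP => e /imsetP[t _ ->]; have [+ _ _ _] := T_triangle t.
by case: (T t) => [[x y] z] /= /card_edge/eqP.
Qed.

Lemma card_T_family : #|H| = n * m.
Proof.
rewrite card_imset ?card_prod ?card_ord // => -[x i] [y k] E.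
have [? ? ? ?] := abc (ltn_ord i); have [? ? ? ?] := abc (ltn_ord k).
have [cwT ga _ _] := T_triangle (x, i); have := T_gaps cwT E; rewrite {}ga /=.
(* The first gap [a i] is at most [m], so it is no [b] or [c] value and the two readings start at
   the same vertex. *)
by case=> [[-> /a_inj/val_inj -> _]|[]|[]] //; move=> ? ?; exfalso; lia.
Qed.

End LowerBound.

(** * Bounds on the extremal number *)

Lemma ex_D2_le n : 1 < n -> 9 * ex_cyc n D2 + 3 * n <= 2 * n ^ 2.
Proof.
(* Isolates the maximum; for [n > 1] the subtraction does not truncate. *)
move=> n1; suff : ex_cyc n D2 <= (2 * n ^ 2 - 3 * n) %/ 9 by nia.
apply/bigmax_leqP => H /andP[cH fH].
by have := card_D2_free_le cH fH n1; lia.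
Qed.

Lemma ex_D2_ge n : 2 * n * n <= 9 * ex_cyc n D2 + 19 * n.
Proof.
(* For [n < 6] the term [19 n] alone covers [2 n^2]. *)
have [n6|n6] := ltnP n 6; first by nia.
have [m [a [b [c [mn abc ai bi ci]]]]] := sum_constant_triples n6.
have n0 : 0 < n by lia.
have : n * m <= ex_cyc n D2.
  rewrite -(card_T_family n0 abc ai).
  by apply: leq_bigmax_cond; rewrite (T_family_cgh n0 abc) (T_family_free n0 abc ai bi ci).
by nia.
Qed.

Local Open Scope ring_scope.

Theorem theorem6 :
  exists c : rat, 0 < c /\
    forall n : nat, (3 <= n)%N ->
      4 / 9 * ('C(n, 2))%:R - c * n%:R <= (ex_cyc n D2)%:R /\
      (ex_cyc n D2)%:R <= (2 * n%:R ^+ 2 - 3 * n%:R) / 9 :> rat.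
Proof.
(* The main term is [(2 n^2 - 2 n) / 9] and the construction loses at most [19 n / 9], so the error
   is at most [17 n / 9 <= 2 n]. *)
exists 2; split=> // n n3.
have := ex_D2_ge n; have := @ex_D2_le n (ltnW n3); move: (ex_cyc n D2) => e.
have : ('C(n, 2) * 2 + n = n * n)%N.
  by rewrite bin2 muln2; have := odd_double_half (n * n.-1); rewrite oddM; nia.
move: 'C(n, 2) => k /(congr1 (fun x => x%:R : rat)).
rewrite -!(ler_nat rat) !(natrD, natrM, natrX) => hk hu hl.
split; lra.
Qed.
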